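(* The calculus $\mathbf{L}^{\Lambda}_{\backslash,/}\wedge$ is strongly complete with respect to the class of square R-models: for every set $\mathcal{H}$ of sequents and every sequent $\Pi\to B$ in the language of $\backslash,/,\wedge$, if $\Pi\to B$ is true in every square R-model in which all sequents of $\mathcal{H}$ are true, then $\Pi\to B$ is derivable from $\mathcal{H}$ in $\mathbf{L}^{\Lambda}_{\backslash,/}\wedge$.
   Context: Formulae are built from a countable set of propositional variables using the binary connectives $\backslash$, $/$, $\wedge$. A sequent is $\Pi \to B$ with $B$ a formula and $\Pi$ a finite, possibly empty, sequence of formulae (empty sequence written $\Lambda$). The calculus $\mathbf{L}^{\Lambda}_{\backslash,/}\wedge$ has axiom $A\to A$ and rules (capital Greek letters denote possibly empty sequences): (Cut) from $\Pi \to A$ and $\Gamma, A, \Delta \to C$ infer $\Gamma,\Pi,\Delta\to C$; ($\backslash L$) from $\Pi\to A$ and $\Gamma,B,\Delta\to C$ infer $\Gamma,\Pi,A\backslash B,\Delta\to C$; ($\backslash R$) from $A,\Pi\to B$ infer $\Pi\to A\backslash B$; ($/ L$) from $\Pi\to A$ and $\Gamma,B,\Delta\to C$ infer $\Gamma,B/A,\Pi,\Delta\to C$; ($/R$) from $\Pi,A\to B$ infer $\Pi\to B/A$; ($\wedge L$) from $\Gamma,A,\Delta\to C$ infer both $\Gamma,A\wedge B,\Delta\to C$ and $\Gamma,B\wedge A,\Delta\to C$; ($\wedge R$) from $\Pi\to A$ and $\Pi\to B$ infer $\Pi\to A\wedge B$. A sequent is derivable from a set of sequents $\mathcal H$ if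 it is derivable when the sequents of $\mathcal H$ are added as extra axioms. For binary relations $R,S$ on a non-empty set $W$: $R\circ S=\{(x,z) \mid \exists y\,((x,y)\in R, (y,z)\in S)\}$; $R\backslash S=\{(y,z)\in W\times W \mid \forall x\,((x,y)\in R\Rightarrow (x,z)\in S)\}$; $S/R=\{(x,y)\in W\times W \mid \forall z\,((y,z)\in R\Rightarrow(x,z)\in S)\}$; $\delta=\{(x,x)\mid x\in W\}$. A square R-model is a pair $(W,v)$ with $W$ non-empty and $v$ assigning to each formula a binary relation on $W$ such that $v(A\backslash B)=v(A)\backslash v(B)$, $v(B/A)=v(B)/v(A)$, $v(A\wedge B)=v(A)\cap v(B)$. A sequent $A_1,\ldots,A_n\to B$ ($n\ge1$) is true in the model if $v(A_1)\circ\cdots\circ v(A_n)\subseteq v(B)$, and $\Lambda\to B$ is true if $\delta\subseteq v(B)$. *)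

(* Defs.v *)
From Stdlib Require Export List Relations.
Export ListNotations.

(** [Over B A] is B / A: the denominator comes second, as in the infix notation. *)
Inductive formula : Type :=
| Var (p : nat)
| Under (A B : formula)
| Over (B A : formula)
| Meet (A B : formula).

Record sequent : Type := Sequent { antecedent : list formula; succedent : formula }.

Notation "Pi =>> B" := (Sequent Pi B) (at level 70, no associativity).

Inductive derivable (H : sequent -> Prop) : sequent -> Prop :=
| d_hyp s : H s -> derivable H s
| d_ax A : derivable H ([A] =>> A)
| d_cut Pi Gamma Delta A C :
    derivable H (Pi =>> A) ->
    derivable H (Gamma ++ [A] ++ Delta =>> C) ->
    derivable H (Gamma ++ Pi ++ Delta =>> C)
| d_under_l Pi Gamma Delta A B C :
    derivable H (Pi =>> A) ->
    derivable H (Gamma ++ [B] ++ Delta =>> C) ->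
    derivable H (Gamma ++ Pi ++ [Under A B] ++ Delta =>> C)
| d_under_r Pi A B :
    derivable H ([A] ++ Pi =>> B) ->
    derivable H (Pi =>> Under A B)
| d_over_l Pi Gamma Delta A B C :
    derivable H (Pi =>> A) ->
    derivable H (Gamma ++ [B] ++ Delta =>> C) ->
    derivable H (Gamma ++ [Over B A] ++ Pi ++ Delta =>> C)
| d_over_r Pi A B :
    derivable H (Pi ++ [A] =>> B) ->
    derivable H (Pi =>> Over B A)
| d_meet_l1 Gamma Delta A B C :
    derivable H (Gamma ++ [A] ++ Delta =>> C) ->
    derivable H (Gamma ++ [Meet A B] ++ Delta =>> C)
| d_meet_l2 Gamma Delta A B C :
    derivable H (Gamma ++ [A] ++ Delta =>> C) ->
    derivable H (Gamma ++ [Meet B A] ++ Delta =>> C)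
| d_meet_r Pi A B :
    derivable H (Pi =>> A) ->
    derivable H (Pi =>> B) ->
    derivable H (Pi =>> Meet A B).

Definition rcomp {W : Type} (R S : relation W) : relation W :=
  fun x z => exists y, R x y /\ S y z.

Definition runder {W : Type} (R S : relation W) : relation W :=
  fun y z => forall x, R x y -> S x z.

Definition rover {W : Type} (S R : relation W) : relation W :=
  fun x y => forall z, R y z -> S x z.

Definition rmeet {W : Type} (R S : relation W) : relation W :=
  fun x y => R x y /\ S x y.

Definition rdelta (W : Type) : relation W := fun x y => x = y.

(** Equality of relations is extensional ([same_relation], mutual inclusion). *)
Record square_rmodel : Type := SquareRModel {
  world : Type;
  world_nonempty : inhabited world;
  val : formula -> relation world;
  val_under A B : same_relation world (val (Under A B)) (runder (val A) (val B));
  val_over A B : same_relation world (val (Over B A)) (rover (val B) (val A));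
  val_meet A B : same_relation world (val (Meet A B)) (rmeet (val A) (val B))
}.

(** v(A) o v(A_1) o ... o v(A_n) for l = [A_1; ...; A_n]; no identity relation
    is appended at the end. *)
Fixpoint val_seq (M : square_rmodel) (A : formula) (l : list formula) :
    relation (world M) :=
  match l with
  | [] => val M A
  | B :: l' => rcomp (val M A) (val_seq M B l')
  end.

Definition true_in (M : square_rmodel) (s : sequent) : Prop :=
  match antecedent s with
  | [] => inclusion (world M) (rdelta (world M)) (val M (succedent s))
  | A :: l => inclusion (world M) (val_seq M A l) (val M (succedent s))
  end.

(* Main.v *)
From Stdlib Require Import Bool.
Require Import Defs.

(** The words [u] with [u =>> A] derivable form a language [V A] over the alphabet of
    formulae, and these languages respect the residuals and meet of the free monoid.
    The worlds are the elements of the free group on the formulae, and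
    [v A = {(x, x u) | u in V A}].  The only danger is that the residuals, now computed in
    the group, contain non-positive elements.  They do not: if [h g] is positive for all
    [h] in [V A], then this holds for [h = A] and for [h = (A / q) q] with [q <> A]; the first
    says that [g] is positive or its reduced form starts with [A^-1], and the second excludes
    the latter. *)

(** * Free groups *)

Section FreeGroup.

Variable T : Type.
Hypothesis T_eq_dec : forall a b : T, {a = b} + {a <> b}.

(* [(true, a)] is the generator [a] and [(false, a)] its inverse.  Words are not required to
   be reduced: equality in the free group is equality of [norm]. *)
Definition letter : Type := bool * T.
Definition word : Type := list letter.

Definition linv (a : letter) : letter := (negb (fst a), snd a).
Definition winv (x : word) : word := rev (map linv x).
Definition signed (s : bool) (u : list T) : word := map (pair s) u.

Lemma letter_eq_dec (a b : letter) : {a = b} + {a <> b}.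
Proof. decide equality; apply bool_dec. Qed.

Definition push (a : letter) (x : word) : word :=
  match x with
  | [] => [a]
  | b :: x' => if letter_eq_dec b (linv a) then x' else a :: x
  end.

Definition norm (x : word) : word := fold_right push [] x.

Fixpoint reduced (x : word) : Prop :=
  match x with
  | [] => True
  | a :: x' => match x' with [] => True | b :: _ => b <> linv a end /\ reduced x'
  end.

Lemma linv_involutive a : linv (linv a) = a.
Proof. now destruct a as [[] a]. Qed.

Lemma push_reduced a x : reduced x -> reduced (push a x).
Proof.
  destruct x as [|b x]; cbn; [easy|].
  destruct (letter_eq_dec b (linv a)) as [_|n]; cbn; intuition.
Qed.

Lemma norm_reduced x : reduced (norm x).
Proof. induction x as [|a x IH]; cbn; [easy|]. now apply push_reduced. Qed.

Lemma push_linv a x : reduced x -> push (linv a) (push a x) = x.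
Proof.
  destruct x as [|b x]; cbn [push].
  - destruct (letter_eq_dec a (linv (linv a))) as [_|n]; [easy|].
    now rewrite linv_involutive in n.
  - intros [hb _]. destruct (letter_eq_dec b (linv a)) as [->|n].
    (* After [push a] removes [linv a], putting it back must not cancel again: [linv a :: c :: x] is
       reduced, so [c] is not [a]. *)
    + destruct x as [|c x]; cbn; [easy|].
      now destruct (letter_eq_dec c (linv (linv a))).
    + cbn. destruct (letter_eq_dec a (linv (linv a))) as [_|n']; [easy|].
      now rewrite linv_involutive in n'.
Qed.

Lemma norm_linv a x : norm (linv a :: a :: x) = norm x.
Proof. apply push_linv, norm_reduced. Qed.

Lemma norm_linv_r a x : norm (a :: linv a :: x) = norm x.
Proof. rewrite <- (linv_involutive a) at 1. apply norm_linv. Qed.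

(** * Congruence and inverses *)

Lemma norm_app_l l x y : norm x = norm y -> norm (l ++ x) = norm (l ++ y).
Proof. unfold norm. rewrite !fold_right_app. now intros ->. Qed.

(** Congruence on the right rests on this, whereas on the left it is immediate from the fold. The
    only real case is a letter cancelling against the head of [norm x]. *)
Lemma norm_norm_app x l : norm (norm x ++ l) = norm (x ++ l).
Proof.
  induction x as [|a x IH]; [easy|].
  change (norm (a :: x)) with (push a (norm x)).
  change (norm ((a :: x) ++ l)) with (push a (norm (x ++ l))).
  rewrite <- IH. destruct (norm x) as [|b y]; [easy|]. cbn [push].
  destruct (letter_eq_dec b (linv a)) as [->|n]; [|easy].
  symmetry. apply (norm_linv_r a (y ++ l)).
Qed.

Lemma norm_app_r l x y : norm x = norm y -> norm (x ++ l) = norm (y ++ l).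
Proof. intros e. now rewrite <- norm_norm_app, e, norm_norm_app. Qed.

Lemma winv_app x y : winv (x ++ y) = winv y ++ winv x.
Proof. unfold winv. now rewrite map_app, rev_app_distr. Qed.

Lemma winv_involutive x : winv (winv x) = x.
Proof.
  unfold winv. rewrite map_rev, rev_involutive, map_map.
  rewrite <- (map_id x) at 2. apply map_ext, linv_involutive.
Qed.

Lemma norm_winv_app x l : norm (winv x ++ x ++ l) = norm l.
Proof.
  revert l. induction x as [|a x IH]; intros l; [easy|].
  change (a :: x) with ([a] ++ x). rewrite winv_app, <- !app_assoc.
  rewrite <- (IH l). apply norm_app_l. apply (norm_linv a).
Qed.

Lemma norm_app_winv x l : norm (x ++ winv x ++ l) = norm l.
Proof. rewrite <- (winv_involutive x) at 1. apply norm_winv_app. Qed.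

Lemma norm_app_cancel_l l x y : norm (l ++ x) = norm (l ++ y) -> norm x = norm y.
Proof.
  intros e. rewrite <- (norm_winv_app l x), <- (norm_winv_app l y). now apply norm_app_l.
Qed.

Lemma norm_app_move_r x y l : norm (x ++ l) = norm y -> norm x = norm (y ++ winv l).
Proof.
  intros e. apply (norm_app_r (winv l)) in e. rewrite <- e, <- app_assoc.
  rewrite <- (app_nil_r x) at 1. apply norm_app_l.
  rewrite <- (app_nil_r (winv l)). symmetry. apply norm_app_winv.
Qed.

Lemma norm_winv x y : norm x = norm y -> norm (winv x) = norm (winv y).
Proof.
  intros e. apply (norm_app_cancel_l x).
  rewrite (norm_app_r (winv y) _ _ e), <- (app_nil_r (winv x)), <- (app_nil_r (winv y)).
  now rewrite !norm_app_winv.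
Qed.

(** * Words of a single sign *)

Lemma winv_signed s u : winv (signed s u) = signed (negb s) (rev u).
Proof. unfold winv, signed. now rewrite map_map, map_rev. Qed.

(** Inverse letters have opposite signs, so nothing cancels. Hence the free monoid embeds in the
    free group. *)
Lemma norm_signed s u : norm (signed s u) = signed s u.
Proof.
  induction u as [|a u IH]; [easy|].
  change (norm (signed s (a :: u))) with (push (s, a) (norm (signed s u))). rewrite IH.
  destruct u as [|b u]; [easy|]. cbn [signed map push].
  destruct (letter_eq_dec (s, b) (linv (s, a))) as [e|_]; [|easy].
  injection e. now destruct s.
Qed.

Lemma signed_norm_inj s u u' : norm (signed s u) = norm (signed s u') -> u = u'.
Proof.
  rewrite !norm_signed. revert u'.
  induction u as [|a u IH]; intros [|b u'] [=]; [easy|].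
  f_equal; [easy|]. now apply IH.
Qed.

Lemma push_signed s a u :
  push (negb s, a) (signed s u) =
    match u with
    | [] => [(negb s, a)]
    | b :: u' => if T_eq_dec b a then signed s u' else (negb s, a) :: signed s u
    end.
Proof.
  destruct u as [|b u]; [easy|]. cbn [signed map push].
  destruct (letter_eq_dec (s, b) (linv (negb s, a))) as [e|n], (T_eq_dec b a) as [e'|n'];
    try easy; unfold linv in *; cbn in *; rewrite negb_involutive in *; congruence.
Qed.

(* For [s = true]: if [a^-1 w1 = (b c)^-1 w2] with [a <> c], this element is positive. *)
Lemma signed_starts_with s a b c w1 w2 :
  a <> c ->
  norm ((negb s, a) :: signed s w1) = norm ((negb s, c) :: (negb s, b) :: signed s w2) ->
  exists w, w1 = a :: w.
Proof.
  intros nac e.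
  change (push (negb s, a) (norm (signed s w1))
          = push (negb s, c) (push (negb s, b) (norm (signed s w2)))) in e.
  rewrite !norm_signed, !push_signed in e.
  (* Either the first letter cancels against [w1], which is the claim, or it survives at the head of
     the reduced left side. *)
  assert (starts : exists x, push (negb s, a) (signed s w1) = (negb s, a) :: x
                    \/ exists w, w1 = a :: w).
  { rewrite push_signed. destruct w1 as [|d w1]; [now exists []; left|].
    destruct (T_eq_dec d a) as [->|n]; [now exists []; right; exists w1|eauto]. }
  destruct starts as [x [ex|]]; [|easy].
  rewrite push_signed in ex. rewrite ex in e.
  (* The reduced right side begins with [(negb s, c)], or else [b] and [c] both cancel and only
     letters of sign [s] remain. Neither can begin with [(negb s, a)]. *)
  assert (neg_c : forall y, (negb s, a) :: x <> (negb s, c) :: y) by congruence.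
  assert (nn : forall y, push (negb s, c) ((negb s, b) :: y) = (negb s, c) :: (negb s, b) :: y).
  { intros y. cbn [push]. destruct (letter_eq_dec (negb s, b) (linv (negb s, c))) as [e'|_]; [|easy].
    injection e'. now destruct s. }
  destruct w2 as [|d w2]; [rewrite nn in e; now apply neg_c in e|].
  destruct (T_eq_dec d b) as [_|_]; [|rewrite nn in e; now apply neg_c in e].
  rewrite push_signed in e.
  destruct w2 as [|d' w2]; [now apply neg_c in e|].
  destruct (T_eq_dec d' c) as [_|_]; [|now apply neg_c in e].
  exfalso. destruct w2 as [|d'' w2]; cbn in e; [easy|].
  injection e as e _ _. now destruct s.
Qed.

(** Inversion reverses words and flips signs, reducing this to [signed_starts_with] at [negb s];
    that is why the sign is a parameter there. *)
Lemma signed_ends_with s a b c w1 w2 :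
  a <> c ->
  norm (signed s w1 ++ [(negb s, a)]) = norm (signed s w2 ++ [(negb s, b); (negb s, c)]) ->
  exists w, w1 = w ++ [a].
Proof.
  intros nac e. apply norm_winv in e. rewrite !winv_app, !winv_signed in e.
  destruct (signed_starts_with (negb s) a b c (rev w1) (rev w2) nac e) as [w ew].
  exists (rev w). now rewrite <- (rev_involutive w1), ew.
Qed.

End FreeGroup.

Arguments norm {T} _ _.
Arguments signed {T} _ _.

(** * The canonical model *)

Lemma formula_eq_dec (A B : formula) : {A = B} + {A <> B}.
Proof. decide equality. decide equality. Qed.

(** Supplies a formula [q = Meet A A] distinct from [A] for the residual cases. *)
Lemma neq_meet (A B : formula) : A <> Meet A B.
Proof. revert B. induction A; intros C [=]. eapply IHA1; eassumption. Qed.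

Section CanonicalModel.

Variable H : sequent -> Prop.

Let nrm := norm formula_eq_dec.
Let pos := @signed formula true.

Definition can_val (A : formula) (x y : word formula) : Prop :=
  exists u, derivable H (u =>> A) /\ nrm y = nrm (x ++ pos u).

(** * Inverting the right rules by cut *)

Lemma derivable_under_inv u w A B :
  derivable H (u =>> A) -> derivable H (w =>> Under A B) -> derivable H (u ++ w =>> B).
Proof.
  intros dA dAB. rewrite <- (app_nil_r w).
  apply (d_cut H w u [] (Under A B)); [easy|].
  apply (d_under_l H u [] []); [easy|apply d_ax].
Qed.

Lemma derivable_over_inv u w A B :
  derivable H (u =>> A) -> derivable H (w =>> Over B A) -> derivable H (w ++ u =>> B).
Proof.
  intros dA dAB. apply (d_cut H w [] u (Over B A)); [easy|].
  rewrite <- (app_nil_r u).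
  apply (d_over_l H u [] []); [easy|apply d_ax].
Qed.

Lemma derivable_meet_inv u A B :
  derivable H (u =>> Meet A B) -> derivable H (u =>> A) /\ derivable H (u =>> B).
Proof.
  intros d. rewrite <- (app_nil_r u). split.
  - apply (d_cut H u [] [] (Meet A B)); [easy|]. apply d_meet_l1, d_ax.
  - apply (d_cut H u [] [] (Meet A B)); [easy|]. apply d_meet_l2, d_ax.
Qed.

Lemma pos_app u w : pos (u ++ w) = pos u ++ pos w.
Proof. apply map_app. Qed.

Lemma can_val_app x y u w :
  nrm y = nrm (x ++ pos u) -> nrm (y ++ pos w) = nrm (x ++ pos (u ++ w)).
Proof. intros e. rewrite pos_app, app_assoc. now apply norm_app_r. Qed.

(** * Residuals and meet of the canonical relations *)

Lemma can_val_under A B :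
  same_relation _ (can_val (Under A B)) (runder (can_val A) (can_val B)).
Proof.
  split.
  - intros y z [w [dw ez]] x [u [du ey]]. exists (u ++ w).
    split; [now apply derivable_under_inv with A|]. rewrite ez. now apply can_val_app.
  - intros y z hyz. set (q := Meet A A).
    (* In the group [y] has a predecessor [y u^-1] for every [u], whether or not [y] ends in [u]. *)
    assert (back : forall u, derivable H (u =>> A) ->
              can_val A (y ++ winv formula (pos u)) y).
    { intros u du. exists u. split; [easy|]. rewrite <- app_assoc.
      rewrite <- (app_nil_r y) at 1. apply norm_app_l.
      rewrite <- (winv_involutive _ (pos u)) at 2.
      rewrite <- (app_nil_r (winv _ (winv _ _))). symmetry. apply norm_app_winv. }
    destruct (hyz _ (back [A] (d_ax H A))) as [w1 [d1 e1]].
    (* A second word deriving [A], whose last letter differs from [A]. *)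
    assert (dq : derivable H ([Over A q; q] =>> A))
      by exact (derivable_over_inv _ _ _ _ (d_ax H q) (d_ax H (Over A q))).
    destruct (hyz _ (back _ dq)) as [w2 [_ e2]].
    rewrite <- app_assoc in e1, e2.
    destruct (signed_starts_with formula formula_eq_dec true A (Over A q) q w1 w2) as [w ->].
    { apply neq_meet. }
    { apply (norm_app_cancel_l _ _ y). etransitivity; [symmetry; exact e1|exact e2]. }
    (* Now [w1 = A w] derives [B], and [z = y A^-1 A w = y w]. *)
    exists w. split; [now apply d_under_r|].
    rewrite e1. apply norm_app_l. apply (norm_linv _ _ (true, A)).
Qed.

Lemma can_val_over A B :
  same_relation _ (can_val (Over B A)) (rover (can_val B) (can_val A)).
Proof.
  split.
  - intros x y [w [dw ey]] z [u [du ez]]. exists (w ++ u).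
    split; [now apply derivable_over_inv with A|]. rewrite ez. now apply can_val_app.
  - intros x y hxy. set (q := Meet A A).
    assert (fwd : forall u, derivable H (u =>> A) -> can_val A y (y ++ pos u))
      by (intros u du; now exists u).
    destruct (hxy _ (fwd [A] (d_ax H A))) as [w1 [d1 e1]].
    (* The mirror image: the last letter [Under q A] must differ from [A], and again [neq_meet] is
       invoked. *)
    assert (dq : derivable H ([q; Under q A] =>> A))
      by exact (derivable_under_inv _ _ _ _ (d_ax H q) (d_ax H (Under q A))).
    destruct (hxy _ (fwd _ dq)) as [w2 [_ e2]].
    apply norm_app_move_r in e1, e2. rewrite <- app_assoc in e1, e2.
    destruct (signed_ends_with formula formula_eq_dec true A (Under q A) q w1 w2) as [w ->].
    { apply neq_meet. }
    { apply (norm_app_cancel_l _ _ x). etransitivity; [symmetry; exact e1|exact e2]. }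
    exists w. split; [now apply d_over_r|].
    unfold nrm. rewrite e1. apply norm_app_l.
    fold pos. rewrite pos_app, <- app_assoc. rewrite <- (app_nil_r (pos w)) at 2.
    apply norm_app_l. apply (norm_linv_r _ _ (true, A)).
Qed.

Lemma can_val_meet A B :
  same_relation _ (can_val (Meet A B)) (rmeet (can_val A) (can_val B)).
Proof.
  split.
  - intros x y [u [du ey]]. apply derivable_meet_inv in du. split; exists u; tauto.
  - intros x y [[u [du eu]] [w [dw ew]]]. exists u. split; [|easy].
    apply d_meet_r; [easy|].
    (* Both words represent [x^-1 y], and positive words equal in the group coincide. *)
    replace u with w; [easy|]. symmetry.
    apply (signed_norm_inj _ formula_eq_dec true), (norm_app_cancel_l _ _ x).
    etransitivity; [symmetry; exact eu|exact ew].
Qed.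

(** * Truth in the canonical model *)

Definition can_model : square_rmodel :=
  SquareRModel (word formula) (inhabits []) can_val can_val_under can_val_over can_val_meet.

(** Cuts replace the formulae by words from left to right; [Gamma] collects the words already
    substituted. *)
Lemma can_val_seq_word A l x y :
  val_seq can_model A l x y ->
  exists u, nrm y = nrm (x ++ pos u) /\
    forall Gamma C, derivable H (Gamma ++ A :: l =>> C) -> derivable H (Gamma ++ u =>> C).
Proof.
  revert A x. induction l as [|B l IH]; intros A x; cbn.
  - intros [u [du e]]. exists u. split; [easy|]. intros Gamma C d.
    rewrite <- (app_nil_r u). now apply d_cut with A.
  - intros [t [[u [du e]] hl]]. apply IH in hl as [w [ew hw]].
    exists (u ++ w). split; [rewrite ew; now apply can_val_app|].
    intros Gamma C d. rewrite app_assoc. apply hw. rewrite <- app_assoc.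
    now apply d_cut with A.
Qed.

Lemma can_val_seq_self A l x : val_seq can_model A l x (x ++ pos (A :: l)).
Proof.
  revert A x. induction l as [|B l IH]; intros A x; cbn.
  - exists [A]. split; [apply d_ax|easy].
  - exists (x ++ pos [A]). split; [exists [A]; split; [apply d_ax|easy]|].
    change (val_seq can_model B l (x ++ pos [A]) (x ++ pos [A] ++ pos (B :: l))).
    rewrite app_assoc. apply IH.
Qed.

Lemma can_model_sound s : H s -> true_in can_model s.
Proof.
  destruct s as [[|A l] C]; intros hs; unfold true_in; cbn [antecedent succedent].
  - intros x y <-. exists []. split; [now apply d_hyp|]. cbn. now rewrite app_nil_r.
  - intros x y hxy. apply can_val_seq_word in hxy as [u [e du]].
    exists u. split; [|easy]. now apply (du []), d_hyp.
Qed.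

(** Evaluate at the pair from the identity to [Pi]: truth gives a word that derives [B] and equals
    [Pi] in the group, hence is [Pi]. *)
Lemma can_model_complete Pi B : true_in can_model (Pi =>> B) -> derivable H (Pi =>> B).
Proof.
  intros t.
  assert (hv : can_val B [] (pos Pi)).
  { destruct Pi as [|A l]; apply t; [reflexivity|apply (can_val_seq_self A l [])]. }
  destruct hv as [u [du e]]. now apply signed_norm_inj in e as ->.
Qed.

End CanonicalModel.

Theorem theorem7p6 (H : sequent -> Prop) (Pi : list formula) (B : formula) :
  (forall M : square_rmodel,
      (forall s : sequent, H s -> true_in M s) -> true_in M (Pi =>> B)) ->
  derivable H (Pi =>> B).
Proof.
  intros valid. apply can_model_complete, valid. apply can_model_sound.
Qed.
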